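(* If $\mathsf{\Delta}^\circ_\omega=\mathfrak c$, then there are $2^{\mathfrak c}$ (pairwise distinct) inseparated cellular finitary coarse structures on $\omega$.
   Context: An entourage on a set $X$ is a set $E\subseteq X\times X$ containing the diagonal $\Delta_X$; $E^{-1}=\{(y,x):(x,y)\in E\}$, $EF=\{(x,z):\exists y\ (x,y)\in E,(y,z)\in F\}$, $E(x)=\{y:(x,y)\in E\}$, $E[A]=\bigcup_{a\in A}E(a)$. A coarse structure on $X$ is a family $\mathcal E$ of entourages on $X$ such that $\bigcup\mathcal E=X\times X$; for any $E,F\in\mathcal E$ there is $T\in\mathcal E$ with $EF^{-1}\subseteq T$; and every entourage contained in a member of $\mathcal E$ belongs to $\mathcal E$. A base of $\mathcal E$ is a subfamily $\mathcal B\subseteq\mathcal E$ such that each $E\in\mathcal E$ is contained in some $B\in\mathcal B$; the weight $w(\mathcal E)$ is the smallest cardinality of a base. $\mathcal E$ is cellular if it has a base consisting of equivalence relations; finitary if $\sup_{x\in X}|E(x)|$ is finite for every $E\in\mathcal E$. A set $A\subseteq X$ is $\mathcal E$-bounded if $A\subseteq E(x)$ for some $E\in\mathcal E$, $x\in X$, and $\mathcal E$-unbounded otherwise; $\mathcal E$-discrete if for every $E\in\mathcal E$ the set $\{x\in A:A\cap E(x)\ne\{x\}\}$ is $\mathcal E$-bounded. Sets $A,B$ are $\mathcal E$-separated if $E[A]\cap E[B]$ is $\mathcal E$-bounded for every $E\in\mathcal E$. A coarse structure $\mathcal E$ for which $X$ is $\mathcal E$-unbounded is called indiscrete if each $\mathcal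 E$-discrete subset of $X$ is $\mathcal E$-bounded; inseparated if $X$ contains no $\mathcal E$-separated $\mathcal E$-unbounded sets $A,B$. $\mathfrak c=2^{\aleph_0}$, $\mathfrak c^+$ is its cardinal successor, and $\mathsf{\Delta}^\circ_\omega=\min(\{\mathfrak c^+\}\cup\{w(\mathcal E):\mathcal E$ is an indiscrete cellular finitary coarse structure on $\omega\})$. *)

(* Defs.v *)
From mathcomp Require Import all_boot.
From mathcomp Require Import boolp classical_sets functions cardinality.

Set Implicit Arguments.
Unset Strict Implicit.
Unset Printing Implicit Defensive.

Local Open Scope classical_set_scope.
Local Open Scope relation_scope.
Local Open Scope card_scope.

Section Coarse.
Variable X : Type.
Implicit Types (E F T R : set (X * X)) (A B : set X).
Implicit Types (cE base : set (set (X * X))).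

Definition entourage_on E := diagonal `<=` E.

(* The product EF = {(x,z) | exists y, (x,y) in E and (y,z) in F} is written
   [F \; E] with the composition notation of classical_sets, and the section
   E(x) = {y | (x,y) in E} is [xsection E x]. *)
Definition coarse_structure cE :=
  [/\ cE `<=` entourage_on,
      \bigcup_(E in cE) E = [set: X * X],
      forall E F, cE E -> cE F -> exists2 T, cE T & F^-1 \; E `<=` T
    & forall E T, cE E -> entourage_on T -> T `<=` E -> cE T].

Definition entourage_image E A : set X := \bigcup_(a in A) xsection E a.

Definition is_base cE base :=
  base `<=` cE /\ forall E, cE E -> exists2 B, base B & E `<=` B.

Definition equivalence_relation R :=
  [/\ diagonal `<=` R, R^-1 `<=` R & R \; R `<=` R].

Definition cellular cE :=
  exists2 base, is_base cE base & base `<=` equivalence_relation.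

Definition finitary cE :=
  forall E, cE E -> exists n : nat, forall x, xsection E x #<= `I_n.

Definition bounded cE A := exists E x, cE E /\ A `<=` xsection E x.

Definition discrete cE A :=
  forall E, cE E -> bounded cE [set x | A x /\ A `&` xsection E x <> [set x]].

Definition separated cE A B :=
  forall E, cE E -> bounded cE (entourage_image E A `&` entourage_image E B).

Definition indiscrete cE :=
  ~ bounded cE [set: X] /\ forall A, discrete cE A -> bounded cE A.

Definition inseparated cE :=
  ~ bounded cE [set: X] /\
  ~ exists A B, [/\ ~ bounded cE A, ~ bounded cE B & separated cE A B].

End Coarse.

(* There is no type of cardinals in the library: a cardinal is represented by
   any set K of that cardinality, and cardinals are compared with [#<=] and
   [#=]. A class of cardinals is a predicate P on sets over arbitrary types
   (invariant under [#=] below), and [least_cardinal P K] reads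
   "|K| is the minimum of P". *)
Definition least_cardinal (P : forall U : Type, set U -> Prop)
    (U : Type) (K : set U) :=
  P U K /\ forall (V : Type) (L : set V), P V L -> K #<= L.

Definition successor_cardinal (T : Type) (C : set T) :
    forall U : Type, set U -> Prop :=
  least_cardinal (fun V (L : set V) => (C #<= L) && (C #!= L)).

(* w(cE) = |K| *)
Definition has_weight (X : Type) (cE : set (set (X * X))) :
    forall U : Type, set U -> Prop :=
  least_cardinal
    (fun V (L : set V) => exists2 base, is_base cE base & L #= base).

Definition continuum : set (set nat) := [set: set nat].

(* Delta^circ_omega = |K| *)
Definition is_Delta_circ_omega : forall U : Type, set U -> Prop :=
  least_cardinal (fun V (L : set V) =>
    successor_cardinal continuum L \/
    exists cE : set (set (nat * nat)),
      [/\ coarse_structure cE, indiscrete cE, cellular cE, finitary cE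
        & has_weight cE L]).

(* Main.v *)
Require Import Defs.
From mathcomp Require Import all_boot.
From mathcomp Require Import boolp classical_sets functions cardinality.
From mathcomp Require Import wochoice zify.

(** An inseparated structure is built by a transfinite recursion of length c
   along which every pair (A, B) of subsets of omega is considered once.  At
   stage a the relations R_b chosen at the earlier stages b < a generate,
   together with the finite squares [0, n[^2, a cellular finitary structure.  It
   has a base indexed by finite sets of stages below a, hence of fewer than c
   elements because the well-order of the stages has proper initial segments
   smaller than c and an infinite cardinal absorbs products
   ([card_square_le], [joins_small]).  This is where the hypothesis enters: a
   structure of weight below c cannot be indiscrete, and after pulling it back
   along an enumeration of A one even finds an infinite discrete set inside
   every infinite A ([exists_discrete_sub]).

   If A and B are infinite and still separated at stage a, the union of a
   discrete subset of A and a discrete subset of B \ A is discrete, and one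
   enumerates it as f 0, f 1, ... with even terms in A and odd terms in B
   ([exists_discrete_interleaving]).  Adding the relation R_a that links
   consecutive terms in pairs makes A and B non-separated for ever.  Adding it
   keeps the structure finitary: discreteness of the range of f says that,
   outside a finite set, an old equivalence class contains at most one f i, so a
   new class is the union of at most two old ones ([adjoin_link]).  Finitarity
   survives limits, since each member of the base involves finitely many R_b.

   There are two ways of pairing, {0,1}{2,3}... and {1,2}{3,4}..., so each
   subset s of the set of stages steers one construction.  If s and t first
   differ at a, then both constructions have the same f at stage a but use
   different pairings.  An equivalence relation containing both pairings has
   all the f i in one class, so no finitary cellular structure contains both,
   and the two structures are distinct ([branch_inj]).  This gives 2^c
   structures, and there are no more than 2^c families of subsets of
   omega * omega. *)

Set Implicit Arguments.
Unset Strict Implicit.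
Unset Printing Implicit Defensive.

Local Open Scope classical_set_scope.
Local Open Scope card_scope.

Local Notation relN := (set (nat * nat)).

(** * Comparison of cardinals *)

(** Comparing through a relation spares choosing a value outside [A], so
   that [U] need not be pointed. *)
Lemma card_le_relP T U (A : set T) (B : set U) :
  A #<= B <-> exists r : T -> U -> Prop,
    (forall x, A x -> exists2 y, B y & r x y) /\
    (forall x x' y, A x -> A x' -> B y -> r x y -> r x' y -> x = x').
Proof.
split=> [/card_leP[f]|[r [rex rinj]]].
  exists (fun x y => exists Ax : x \in A, y = val (f (SigSub Ax))).
  split=> [x Ax|x x' y _ _ _ [Ax ->] [Ax' /val_inj]].
    have Ax' := mem_set Ax.
    by exists (val (f (SigSub Ax'))); [exact: set_valP|exists Ax'].
  by move=> /(@inj _ _ _ f) => /(_ (mem_set I) (mem_set I)) [].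
have /choice[g gP] (x : A) : exists y : B, r (val x) (val y).
  have [y By rxy] := rex _ (set_valP x).
  by exists (SigSub (mem_set By)).
apply/card_leP/injfunPex; exists g => // x x' _ _ gE; apply: val_inj.
by apply: rinj (gP x) _; rewrite ?gE //; exact: set_valP.
Qed.

Lemma card_le_fun T (U : pointedType) (A : set T) (B : set U) :
  A #<= B -> exists2 f : T -> U,
    (forall x, A x -> B (f x)) &
    (forall x x', A x -> A x' -> f x = f x' -> x = x').
Proof.
move=> /pcard_leP/injfunPex[f fAB finj]; exists f => // x x' Ax Ax'.
by apply: finj; exact: mem_set.
Qed.

Lemma card_le_inj T U (f : T -> U) (A : set T) (B : set U) :
  (forall x, A x -> B (f x)) ->
  (forall x x', A x -> A x' -> f x = f x' -> x = x') -> A #<= B.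
Proof.
move=> fAB finj; apply/card_le_relP; exists (fun x y => y = f x).
by split=> [x Ax|x x' _ Ax Ax' _ ->]; [exists (f x); first exact: fAB|exact: finj].
Qed.

(** Cardinals are well founded. By Zorn's lemma there is a maximal set [S] of
   choice functions of the family [B] any two of which differ at every index.
   Some evaluation map of [S] at an index [i] is onto [B i], since otherwise the
   values that are missed would form one more member of [S]; then [S] is the
   graph of an injection of [B i] into each [B j]. *)
Lemma exists_least_card U (I : Type) (B : I -> set U) (i0 : I) :
  exists i, forall j, B i #<= B j.
Proof.
pose P (S : set (I -> U)) := (forall g, S g -> forall i, B i (g i)) /\
  (forall g h i, S g -> S h -> g i = h i -> g = h).
have [|S [[SB Sinj] Smax]] := @Zorn_bigcup _ P.
  move=> C CP Ctot; split=> [g [X CX Xg]|g h i [X CX Xg] [Y CY Yh]].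
    by apply: (CP _ CX).1.
  have [XY|YX] := Ctot _ _ CX CY.
    by apply: (CP _ CY).2 => //; exact: XY.
  by apply: (CP _ CX).2 => //; exact: YX.
have [i onto] : exists i, forall b, B i b -> exists2 g, S g & g i = b.
  apply: contrapT => /forallNP nonto.
  have /choice[g gP] i : exists b, B i b /\ forall h, S h -> h i <> b.
    have /existsNP[b /not_implyP[Bb nb]] := nonto i.
    by exists b; split=> // h Sh hb; apply: nb; exists h.
  apply: (Smax (S `|` [set g])).
    split=> [h|/(_ g) Sg]; first by left.
    by apply: ((gP i0).2 g _ erefl); apply: Sg; right.
  split=> [h [/SB//|->] i|h k i]; first exact: (gP i).1.
  move=> [Sh|->] [Sk|->] //; first exact: Sinj.
    by move=> /(gP i).2; case.
  by move=> /esym /(gP i).2; case.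
exists i => j; apply/card_le_relP.
exists (fun x y => exists2 g, S g & g i = x /\ g j = y); split.
  by move=> x /onto[g Sg gx]; exists (g j); [exact: SB|exists g].
move=> x x' y _ _ _ [g Sg [<- gy]] [h Sh [<- hy]].
by rewrite (Sinj g h j) // gy hy.
Qed.

Lemma card_le_total T (A B : set T) : A #<= B \/ B #<= A.
Proof.
have [b bP] := exists_least_card (fun b : bool => if b then A else B) true.
by case: b bP => bP; [left; exact: bP false|right; exact: bP true].
Qed.

Lemma card_leX T U T' U' (A : set T) (B : set U) (A' : set T') (B' : set U') :
  A #<= A' -> B #<= B' -> A `*` B #<= A' `*` B'.
Proof.
move=> /card_le_relP[r [rex rinj]] /card_le_relP[q [qex qinj]]; apply/card_le_relP.
exists (fun x y => r x.1 y.1 /\ q x.2 y.2); split.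
  move=> [x y] [/= /rex[x' Ax' rx] /qex[y' By' qy]].
  by exists (x', y').
move=> [x y] [x' y'] [u v] [/= Ax By] [/= Ax' By'] [/= Au Bv] [r1 q1] [r2 q2].
by rewrite (rinj _ _ _ Ax Ax' Au r1 r2) (qinj _ _ _ By By' Bv q1 q2).
Qed.

Lemma card_leU_bool T U (A B : set T) (C : set U) :
  A #<= C -> B #<= C -> A `|` B #<= C `*` [set: bool].
Proof.
move=> /card_le_relP[r [rex rinj]] /card_le_relP[q [qex qinj]]; apply/card_le_relP.
exists (fun x y => if y.2 then A x /\ r x y.1 else B x /\ q x y.1); split.
  move=> x [Ax|Bx].
    by have [y Cy rxy] := rex _ Ax; exists (y, true).
  by have [y Cy qxy] := qex _ Bx; exists (y, false).
move=> x x' [y []] _ _ [/= Cy _] [Ax ?] [Ax' ?].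
  exact: (rinj x x' y).
exact: (qinj x x' y).
Qed.

Lemma card_bool_le U (C : set U) : infinite_set C -> [set: bool] #<= C.
Proof.
move=> /infiniteP; apply: card_le_trans.
by apply: (@card_le_inj _ _ nat_of_bool) => // -[] [].
Qed.

Lemma card_leU T U (A B : set T) (C : set U) : infinite_set C ->
  C `*` C #<= C -> A #<= C -> B #<= C -> A `|` B #<= C.
Proof.
move=> Cinf leCC leAC BC; apply: card_le_trans (card_leU_bool leAC BC) _.
by apply: card_le_trans leCC; apply: card_leX (card_bool_le Cinf).
Qed.

Section SquareInjections.
Variables (T : Type) (K : set T).
Implicit Types G : set (T * T * T).

(** The graphs of the injections of [B * B] into [B], for [B] a subset of [K], are
   ordered by inclusion; [carrier G] recovers [B] from the graph [G]. *)
Definition carrier G : set T :=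
  [set x | exists y z, G (x, y, z) \/ G (y, x, z) \/ G (y, z, x)].

Definition square_injection G := [/\ carrier G `<=` K,
  forall x y, carrier G x -> carrier G y -> exists z, G (x, y, z) &
  forall p p' z z', G (p, z) -> G (p', z') -> p = p' <-> z = z'].

Lemma carrier_sub G G' : G `<=` G' -> carrier G `<=` carrier G'.
Proof.
by move=> GG' x [y [z [|[]] /GG' ?]]; exists y, z; [left|right;left|right;right].
Qed.

Lemma square_injection_card G : square_injection G ->
  carrier G `*` carrier G #<= carrier G.
Proof.
move=> [_ tot fi]; apply/card_le_relP; exists (fun p z => G (p, z)); split.
  move=> [x y] [/= Bx By]; have [z Gz] := tot _ _ Bx By; exists z => //.
  by exists x, y; right; right.
by move=> p p' z _ _ _ Gp Gp'; exact/(fi _ _ _ _ Gp Gp').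
Qed.

(** The pairs of points of the enlarged carrier that are not in the old square
   are sent into [C], away from the values already taken. *)
Lemma extend_square_injection G (C : set T) : square_injection G ->
  C `<=` K `\` carrier G -> C !=set0 ->
  (carrier G `|` C) `*` (carrier G `|` C) #<= C ->
  exists2 G', square_injection G' & G `<` G'.
Proof.
move=> [GK tot fi] CK [c0 Cc0] /card_le_relP[r [rex rinj]].
set B := carrier G in GK tot CK rex rinj *.
have /choice[f fP] p :
    exists z, (B `|` C) p.1 -> (B `|` C) p.2 -> C z /\ r p z.
  have [[p1 p2]|np] := pselect (((B `|` C) `*` (B `|` C)) p).
    by have [z Cz rz] := rex _ (conj p1 p2); exists z.
  by exists c0 => p1 p2; exfalso; apply: np.
pose new (t : T * T * T) := [/\ (B `|` C) t.1.1, (B `|` C) t.1.2,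
  ~ (B t.1.1 /\ B t.1.2) & t.2 = f t.1].
pose G' := G `|` new.
have GB x y z : G (x, y, z) -> [/\ B x, B y & B z].
  by move=> Gxyz; split; [exists y, z; left|exists x, z; right; left
                        |exists x, y; right; right].
have newC x y z : new (x, y, z) -> C z.
  by move=> [/= xB yB _ ->]; case: (fP (x, y) xB yB).
have BC x : B x -> C x -> False by move=> Bx /CK[].
have G'B : carrier G' `<=` B `|` C.
  move=> x [y [z [|[]]]] [/GB[? ? ?]|H]; try by left.
  - by case: H.
  - by case: H.
  - by right; apply: newC H.
exists G'; last first.
  split=> [t|/(_ (c0, c0, f (c0, c0))) sub]; first by left.
  have /GB[/BC//] : G (c0, c0, f (c0, c0)).
  by apply: sub; right; split=> /=; [right|right|case=> /BC|].
split.
- by move=> x /G'B[/GK//|/CK[]].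
- move=> x y /G'B xB /G'B yB.
  have [[Bx By]|nB] := pselect (B x /\ B y).
    by have [z Gz] := tot _ _ Bx By; exists z; left.
  by exists (f (x, y)); right.
move=> [x y] [x' y'] z z' [Gz|Nz] [Gz'|Nz'].
- exact: fi Gz Gz'.
- have [Bx By Bz] := GB _ _ _ Gz; have Cz' := newC _ _ _ Nz'.
  split=> [[xx yy]|zz]; last by case: (BC z) => //; rewrite zz.
  by case: Nz' => /= _ _ []; rewrite -xx -yy.
- have [Bx By Bz] := GB _ _ _ Gz'; have Cz' := newC _ _ _ Nz.
  split=> [[xx yy]|zz]; last by case: (BC z') => //; rewrite -zz.
  by case: Nz => /= _ _ []; rewrite xx yy.
- case: Nz => /= xB yB _ ->; case: Nz' => /= xB' yB' _ ->.
  split=> [-> //|ff].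
  have [Cf rf] := fP (x, y) xB yB; have [_] := fP (x', y') xB' yB'.
  by rewrite -ff; apply: rinj.
Qed.

End SquareInjections.

(** Hessenberg's theorem. Take a maximal injection [B * B -> B] with [B] inside
   [K]. If the complement of [B] is no larger than [B], then [K] injects into
   [B]; otherwise the complement contains a copy of [B], or of [nat] when [B] is
   finite, along which the injection extends, against maximality. *)
Lemma card_square_le T (K : set T) : infinite_set K -> K `*` K #<= K.
Proof.
move=> Kinf; have [|G [GP Gmax]] := @Zorn_bigcup _ (square_injection K).
  move=> C CP Ctot.
  have up X Y : C X -> C Y -> exists Z, [/\ C Z, X `<=` Z & Y `<=` Z].
    by move=> CX CY; have [XY|YX] := Ctot _ _ CX CY; [exists Y|exists X]; split.
  have carE x : carrier (\bigcup_(X in C) X) x -> exists2 X, C X & carrier X x.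
    move=> [y [z [[X CX Xx]|[[X CX Xx]|[X CX Xx]]]]];
      exists X => //; exists y, z.
    - by left.
    - by right; left.
    - by right; right.
  split=> [x /carE[X CX]|x y /carE[X CX Xx] /carE[Y CY Yy]|p p' z z'].
  - by have [XK _ _] := CP _ CX; apply: XK.
  - have [Z [CZ XZ YZ]] := up _ _ CX CY; have [_ tot _] := CP _ CZ.
    have [z Zz] := tot x y (carrier_sub XZ Xx) (carrier_sub YZ Yy).
    by exists z, Z.
  - move=> [X CX Xx] [Y CY Yy].
    have [Z [CZ XZ YZ]] := up _ _ CX CY; have [_ _ fi] := CP _ CZ.
    by apply: fi; [exact: XZ Xx|exact: YZ Yy].
have {}Gmax C : C `<=` K `\` carrier G -> C !=set0 ->
    (carrier G `|` C) `*` (carrier G `|` C) #<= C -> False.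
  by move=> CK C0 leCC; have [G' G'P /Gmax] := extend_square_injection GP CK C0 leCC.
have BK : carrier G `<=` K by case: GP.
have BB := square_injection_card GP.
set B := carrier G in BK BB Gmax *.
have [Bfin|Binf] := pselect (finite_set B).
  have /infiniteP/card_subP[C CE CK] := infinite_setD Kinf Bfin.
  have Cinf : infinite_set C.
    by apply/infiniteP; move: CE; rewrite card_eq_le => /andP[].
  exfalso; apply: (Gmax C) => //; first exact: infinite_setN0.
  have Cnat : [set: nat] #<= C by exact/infiniteP.
  apply: card_le_trans Cnat; apply: countableX; rewrite -bigcup2E /=;
  apply: bigcup_countable => // -[|[|]] //= _; try exact: finite_set_countable;
    by rewrite /countable (card_le_eql CE).
have [KB|] := card_le_total (K `\` B) B.
  have KB' : K #<= B.
    apply: card_le_trans (card_leU Binf BB (card_lexx B) KB).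
    by rewrite setDUK.
  apply: card_le_trans (subset_card_le BK).
  exact: card_le_trans (card_leX KB' KB') BB.
move=> /card_subP[C CE CK]; exfalso; apply: (Gmax C) => //.
  apply: infinite_setN0; rewrite (eq_finite_set CE); exact: Binf.
have [CB BC] : C #<= B /\ B #<= C by move: CE; rewrite card_eq_le => /andP[].
have UB := card_leU Binf BB (card_lexx B) CB.
exact: card_le_trans (card_leX UB UB) (card_le_trans BB BC).
Qed.

Lemma card_seq_le (U : pointedType) (K : set U) : infinite_set K ->
  [set s : seq U | forall x, x \in s -> K x] #<= K.
Proof.
move=> Kinf; have [x0 Kx0] := infinite_setN0 Kinf.
have [p pK pinj] := card_le_fun (card_square_le Kinf).
have /card_le_fun[c cK cinj] : [set: nat] #<= K by exact/infiniteP.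
pose code s := foldr (fun x y => p (x, y)) x0 s.
have codeK s : (forall x, x \in s -> K x) -> K (code s).
  elim: s => // x s IH sK; apply: pK; split; first by apply: sK; rewrite mem_head.
  by apply: IH => y ys; apply: sK; rewrite inE ys orbT.
(* The length is recorded because [code] alone does not see where to stop. *)
apply: (@card_le_inj _ _ (fun s => p (c (size s), code s))).
  by move=> s sK; apply: pK; split=> /=; [exact: cK|exact: codeK].
have pairK n s : (forall x, x \in s -> K x) -> (K `*` K) (c n, code s).
  by move=> sK; split; [exact: cK|exact: codeK].
move=> s t sK tK st; have := pinj _ _ (pairK _ _ sK) (pairK _ _ tK) st.
move=> [/cinj -/(_ I I) sz {}st]; move: st.
elim: s t sK tK sz => [|x s IH] [|y t] //= sK tK [sz] st.
have sK' z : z \in s -> K z by move=> zs; apply: sK; rewrite inE zs orbT.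
have tK' z : z \in t -> K z by move=> zs; apply: tK; rewrite inE zs orbT.
have [Kx Ky] : K x /\ K y by split; [apply: sK|apply: tK]; rewrite mem_head.
have := pinj (x, code s) (y, code t)
  (conj Kx (codeK _ sK')) (conj Ky (codeK _ tK')) st.
by move=> [-> /(IH _ sK' tK' sz) ->].
Qed.

Lemma Cantor_nat : ~ (continuum #<= [set: nat]).
Proof.
move=> /card_le_fun[f _ finj].
pose D := [set n | exists2 A, f A = n & ~ A n].
have [Df|nDf] := pselect (D (f D)); last by apply: (nDf); exists D.
have [A fA nA] := Df; apply: nA.
by have -> : A = D by apply: finj.
Qed.

(** * Well-orders with small initial segments *)

Lemma exists_well_order (T : eqType) : exists lt : T -> T -> Prop,
  well_founded lt /\ forall x y, [\/ lt x y, x = y | lt y x].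
Proof.
have [R Rwo] := well_ordering_principle T.
have Rmin (P : set T) x : P x -> exists2 z, P z & forall y, P y -> R z y.
  move=> Px; have [|z [[/asboolP Pz Rz] _]] := Rwo (fun x => `[< P x >]).
    by exists x; exact/asboolP.
  by exists z => // y Py; apply: Rz; exact/asboolP.
have Rtot x y : R x y \/ R y x.
  have [|z [->|->] Rz] := Rmin [set x; y] x; first by left.
    by left; apply: Rz; right.
  by right; apply: Rz; left.
have Rrefl x : R x x by have [] := Rtot x x.
have Ranti x y : R x y -> R y x -> x = y.
  move=> xy yx; have [|z [_ zu]] := Rwo (pred2 x y).
    by exists x; rewrite inE eqxx.
  have <- : z = x.
    apply: zu; split; first by rewrite inE eqxx.
    by move=> t; rewrite inE => /orP[] /eqP ->.
  apply: zu; split; first by rewrite inE eqxx orbT.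
  by move=> t; rewrite inE => /orP[] /eqP ->.
exists (fun x y => R x y /\ x <> y); split=> [x|x y]; last first.
  have [->|xy] := eqVneq x y; first by constructor 2.
  by have [Rxy|Ryx] := Rtot x y; [constructor 1|constructor 3];
    split=> //; apply/eqP; rewrite // eq_sym.
apply: contrapT => /(Rmin [set x | ~ Acc _ x])[z nz zmin]; apply: nz.
constructor=> y [Ryz yz]; apply: contrapT => /zmin Rzy; apply: yz.
exact: Ranti.
Qed.

(** If some proper initial segment of a well-order of [T] is as large as [T],
   the least such segment is, and pulling the order back along an injection of
   [T] into it makes all initial segments small. *)
Lemma exists_small_well_order (T : pointedType) :
  exists lt : T -> T -> Prop, [/\ well_founded lt,
    forall x y, [\/ lt x y, x = y | lt y x] &
    forall x, ~ ([set: T] #<= [set y | lt y x])].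
Proof.
have [lt [wf tot]] := exists_well_order T.
have [[a big]|nbig] := pselect (exists a, [set: T] #<= [set y | lt y a]);
  last by exists lt; split=> // x big; apply: nbig; exists x.
elim/(well_founded_ind wf): a big => a IH big.
have [[b lt_ba bbig]|nbig] :=
  pselect (exists2 b, lt b a & [set: T] #<= [set y | lt y b]).
  exact: IH lt_ba bbig.
have [g ga ginj] := card_le_fun big.
exists (fun x y => lt (g x) (g y)); split.
- suff gAcc u : Acc lt u -> forall x, g x = u -> Acc (fun x y => lt (g x) (g y)) x.
    by move=> x; exact: gAcc (wf (g x)) _ erefl.
  elim=> {}u _ IHu x gx; constructor=> y /= lt_gyx.
  by apply: (IHu (g y)) => //; rewrite -gx.
- move=> x y; have [gxy|/ginj -/(_ I I)->|gyx] := tot (g x) (g y);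
  by [constructor 1|constructor 2|constructor 3].
move=> x xbig; apply: nbig; exists (g x); first exact: ga.
apply: card_le_trans xbig _.
by apply: (@card_le_inj _ _ g) => // y z _ _; exact: ginj.
Qed.

Lemma wf_asym T (lt : T -> T -> Prop) : well_founded lt ->
  forall a b, lt a b -> lt b a -> False.
Proof.
move=> wf a; elim/(well_founded_ind wf): a => a IH b ltab lt_ba.
exact: (IH b lt_ba a).
Qed.

Lemma wf_total_trans T (lt : T -> T -> Prop) : well_founded lt ->
  (forall a b, [\/ lt a b, a = b | lt b a]) ->
  forall a b c, lt a b -> lt b c -> lt a c.
Proof.
move=> wf tot a; elim/(well_founded_ind wf): a => a IH b c ltab ltbc.
have [//|ac|ltca] := tot a c; exfalso; apply: (wf_asym wf ltbc).
  by rewrite -ac.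
exact: (IH c ltca a b).
Qed.

(** * Coarse structures generated by a directed base of equivalence relations *)

Lemma equivalence_relationP (X : Type) (E : set (X * X)) :
  equivalence_relation E <-> [/\ forall x, E (x, x),
    forall x y, E (x, y) -> E (y, x) &
    forall x y z, E (x, y) -> E (y, z) -> E (x, z)].
Proof.
split=> [[Er Es Et]|[Er Es Et]]; split.
- by move=> x; apply: Er.
- by move=> x y Exy; apply: Es.
- by move=> x y z Exy Eyz; apply: Et; exists y.
- by move=> [x y]; rewrite /diagonal /= => ->.
- by move=> [x y] /= /Es.
- by move=> [x y] [z] /=; exact: Et.
Qed.

(** Finitarity of one relation, with lists in place of cardinals so that unions
   of sections are bounded by concatenation. *)
Definition bounded_sections (T : relN) := exists n, forall x,
  exists2 s : seq nat, size s <= n & forall y, T (x, y) -> y \in s.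

Lemma sub_bounded_sections (E T : relN) :
  E `<=` T -> bounded_sections T -> bounded_sections E.
Proof.
move=> ET [n Tn]; exists n => x; have [s sn Ts] := Tn x.
by exists s => // y /ET /Ts.
Qed.

Lemma card_le_size (e : nat -> nat) (A : set nat) (s : seq nat) n :
  injective e -> (forall x, A x -> e x \in s) -> size s <= n -> A #<= `I_n.
Proof.
move=> einj As sn; apply: (@card_le_inj _ _ (fun x => index (e x) s)).
  by move=> x /As; rewrite -index_mem /= => /leq_trans; exact.
move=> x y /As xs /As ys exy; apply: einj.
by rewrite -(nth_index 0 xs) exy nth_index.
Qed.

Lemma bounded_sections_finite (T : relN) x :
  bounded_sections T -> finite_set [set y | T (x, y)].
Proof.
move=> [n /(_ x)[s _ Ts]]; apply: sub_finite_set (finite_seq s) => y.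
exact: Ts.
Qed.

Section CoarseOfBase.
Variable base : set relN.

Definition equivalence_base := [/\
  forall E, base E -> equivalence_relation E,
  forall E, base E -> bounded_sections E,
  forall E F, base E -> base F -> exists G, [/\ base G, E `<=` G & F `<=` G] &
  forall x y, exists2 E, base E & E (x, y)].

Definition coarse_of : set relN :=
  [set E | diagonal `<=` E /\ exists2 B, base B & E `<=` B].

Hypothesis baseP : equivalence_base.

Lemma base_coarse_of : base `<=` coarse_of.
Proof.
by have [eqB _ _ _] := baseP; move=> E BE; split; [case: (eqB _ BE)|exists E].
Qed.

Lemma is_base_coarse_of : is_base coarse_of base.
Proof. by split=> [|E [_ [B BB EB]]]; [exact: base_coarse_of|exists B]. Qed.

Lemma cellular_coarse_of : cellular coarse_of.
Proof.
by exists base; [exact: is_base_coarse_of|case: baseP].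
Qed.

Lemma finitary_coarse_of : finitary coarse_of.
Proof.
move=> E [_ [B BB EB]]; have [_ /(_ _ BB)[n Bn] _ _] := baseP.
exists n => x; have [s sn Bs] := Bn x.
by apply: (card_le_size (@inj_id _) _ sn) => y /xsectionP/EB; exact: Bs.
Qed.

Lemma coarse_structure_coarse_of : coarse_structure coarse_of.
Proof.
have [eqB _ dirB covB] := baseP; split.
- by move=> E [].
- apply/seteqP; split=> // -[x y] _; have [E BE Exy] := covB x y.
  by exists E => //; exact: base_coarse_of.
- move=> E F [_ [B BB EB]] [_ [C BC FC]].
  have [G [BG BsubG CG]] := dirB _ _ BB BC.
  exists G; first exact: base_coarse_of.
  have /equivalence_relationP[Gr Gs Gt] := eqB _ BG.
  move=> [x z] [y] /= Exy Fzy; apply: (Gt _ y); first exact/BsubG/EB.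
  exact/Gs/CG/FC.
- move=> E T [_ [B BB EB]] diagT TE; split=> //; exists B => //.
  exact: subset_trans EB.
Qed.

Lemma bounded_coarse_of A : bounded coarse_of A <-> finite_set A.
Proof.
have [eqB bndB dirB covB] := baseP; split=> [[E [x [[_ [B BB EB]] AE]]]|].
  apply: sub_finite_set (bounded_sections_finite x (bndB _ BB)) => y /AE.
  by move=> /xsectionP /EB.
move=> /finite_seqP[s ->].
suff [E BE Es] : exists2 E, base E & forall y, y \in s -> E (0, y).
  exists E, 0; split; first exact: base_coarse_of.
  by move=> y /Es ?; apply/xsectionP.
elim: s => [|y s [E BE Es]]; first by have [E BE _] := covB 0 0; exists E.
have [F BF F0y] := covB 0 y; have [G [BG EG FG]] := dirB _ _ BE BF.
by exists G => // z; rewrite inE => /orP[/eqP->|/Es/EG//]; exact: FG.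
Qed.

End CoarseOfBase.

(** [discrete] tested on a base, with bounded sets replaced by finite ones. *)
Definition discrete_for (base : set relN) (D : set nat) :=
  forall E, base E -> finite_set
    [set x | D x /\ exists y, [/\ D y, y <> x & E (x, y)]].

Lemma discrete_coarse_of base D : equivalence_base base ->
  discrete (coarse_of base) D <-> discrete_for base D.
Proof.
move=> baseP; have [eqB _ _ _] := baseP; split=> DD E.
  move=> BE; have := DD E (base_coarse_of baseP BE).
  move=> /(bounded_coarse_of baseP); apply: sub_finite_set => x [Dx [y [Dy yx Exy]]].
  split=> // DE; apply: yx.
  by suff : [set x] y by []; rewrite -DE; split=> //; exact/xsectionP.
move=> [diagE [B BB EB]]; apply/(bounded_coarse_of baseP).
apply: sub_finite_set (DD B BB) => x [Dx DE]; split=> //; apply: contrapT => nD.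
apply: DE; apply/seteqP; split=> y; last first.
  by move=> ->; split=> //; apply/xsectionP; apply: diagE.
move=> [Dy /xsectionP Exy]; apply: contrapT => yx; apply: nD.
by exists y; split=> //; exact: EB.
Qed.

(** * Infinite discrete sets *)

(** Were the structure indiscrete, the minimality of c would make its weight at
   least c, while the base given here is smaller. A base of least cardinality
   must be exhibited because the weight is only given as the least cardinal of
   a class. *)
Lemma exists_infinite_discrete base :
  is_Delta_circ_omega continuum -> equivalence_base base ->
  ~ (continuum #<= base) ->
  exists2 D, infinite_set D & discrete_for base D.
Proof.
move=> [_ Delta_min] baseP small; apply: contrapT => nD; apply: small.
have indisc : indiscrete (coarse_of base).
  split=> [/(bounded_coarse_of baseP)/infinite_nat//|A /(discrete_coarse_of _ baseP) AD].
  by apply/(bounded_coarse_of baseP); apply: contrapT => Ainf; apply: nD; exists A.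
pose bases := {b | is_base (coarse_of base) b}.
pose b0 : bases := exist _ base (is_base_coarse_of baseP).
have [b bmin] := exists_least_card (fun b : bases => proj1_sig b) b0.
apply: card_le_trans (bmin b0); apply: Delta_min; right.
exists (coarse_of base); split=> //.
- exact: coarse_structure_coarse_of.
- exact: cellular_coarse_of.
- exact: finitary_coarse_of.
split; first by exists (proj1_sig b) => //; exact: (proj2_sig b).
move=> V L [b' b'P]; rewrite card_eq_sym card_eq_le => /andP[b'L _].
exact: card_le_trans (bmin (exist _ b' b'P)) b'L.
Qed.

Definition pull (e : nat -> nat) (E : relN) : relN :=
  [set p | E (e p.1, e p.2)].

Lemma equivalence_base_pull e base : injective e ->
  equivalence_base base -> equivalence_base [set pull e E | E in base].
Proof.
move=> einj [eqB bndB dirB covB].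
have /choice[g gK] z : exists y, forall y', e y' = z -> y' = y.
  have [[y <-]|ny] := pselect (exists y, e y = z); first by exists y => y' /einj.
  by exists 0 => y ey; exfalso; apply: ny; exists y.
split.
- move=> _ [E /eqB/equivalence_relationP[Er Es Et] <-].
  apply/equivalence_relationP; rewrite /pull /=; split.
  + by move=> x; exact: Er.
  + by move=> x y; exact: Es.
  + by move=> x y z; exact: Et.
- move=> _ [E /bndB[n En] <-]; exists n => x; have [s sn Es] := En (e x).
  exists (map g s) => [|y /Es esy]; first by rewrite size_map.
  by apply/mapP; exists (e y) => //; exact: gK.
- move=> _ _ [E BE <-] [F BF <-]; have [G [BG EG FG]] := dirB _ _ BE BF.
  exists (pull e G); split; first by exists G.
    by move=> p; exact: EG.
  by move=> p; exact: FG.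
- move=> x y; have [E BE Exy] := covB (e x) (e y).
  by exists (pull e E) => //; exists E.
Qed.

Lemma infinite_set_seq (A : set nat) : infinite_set A ->
  exists2 e : nat -> nat, injective e & forall n, A (e n).
Proof.
move=> /infiniteP/card_le_fun[e eA einj]; exists e => [m n|n]; last exact: eA.
exact: einj.
Qed.

(** Pull the base back along an enumeration of [A]: the pulled back structure
   lives on all of [nat], so [exists_infinite_discrete] applies to it. *)
Lemma exists_discrete_sub base A :
  is_Delta_circ_omega continuum -> equivalence_base base ->
  ~ (continuum #<= base) -> infinite_set A ->
  exists2 f : nat -> nat, injective f &
    (forall n, A (f n)) /\ discrete_for base (range f).
Proof.
move=> Delta baseP small /infinite_set_seq[e einj eA].
have [|D Dinf DD] := exists_infinite_discrete Delta (equivalence_base_pull einj baseP).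
  move=> big; apply: small; exact: card_le_trans big (card_image_le _ _).
have [d dinj dD] := infinite_set_seq Dinf.
exists (e \o d); first exact: inj_comp.
split=> [n|E BE]; first exact: eA.
apply: sub_finite_set (finite_image e (DD (pull e E) _)); last by exists E.
move=> _ [[m _ <-] [_ [[n _ <-] nm Emn]]]; exists (d m) => //=.
split; first exact: dD.
by exists (d n); split=> // dnm; apply: nm; rewrite /= dnm.
Qed.

(** [separated] tested on a base, with bounded sets replaced by finite ones. *)
Definition separated_for (base : set relN) (A B : set nat) :=
  forall E, base E -> finite_set
    [set x | exists2 a, A a & exists2 b, B b & E (a, x) /\ E (b, x)].

Lemma separated_coarse_of base A B : equivalence_base base ->
  separated (coarse_of base) A B <-> separated_for base A B.
Proof.
move=> baseP; split=> sAB E.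
  move=> BE; have := sAB E (base_coarse_of baseP BE).
  move=> /(bounded_coarse_of baseP); apply: sub_finite_set.
  move=> x [a Aa [b Bb [Eax Ebx]]].
  by split; [exists a|exists b] => //; exact/xsectionP.
move=> [_ [F BF EF]]; apply/(bounded_coarse_of baseP).
apply: sub_finite_set (sAB F BF) => x [[a Aa /xsectionP Eax] [b Bb /xsectionP Ebx]].
by exists a => //; exists b => //; split; exact: EF.
Qed.

(** The union of a discrete [D] in [A] and a discrete [D'] in [B] is discrete when
   [A] and [B] are separated: two related points lie both in [D], both in [D'],
   or one in [A] and the other in [B]. Choosing [D'] outside [A] keeps the
   enumeration injective. *)
Lemma exists_discrete_interleaving base A B :
  is_Delta_circ_omega continuum -> equivalence_base base ->
  ~ (continuum #<= base) -> infinite_set A -> infinite_set B ->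
  separated_for base A B ->
  exists f : nat -> nat, [/\ injective f, discrete_for base (range f) &
    forall n, A (f n.*2) /\ B (f n.*2.+1)].
Proof.
move=> Delta baseP small Ainf Binf sAB; have [eqB _ _ covB] := baseP.
have ABfin : finite_set (A `&` B).
  have [E BE _] := covB 0 0; have /equivalence_relationP[Er _ _] := eqB _ BE.
  by apply: sub_finite_set (sAB E BE) => x [Ax Bx]; exists x => //; exists x.
have BAinf : infinite_set (B `\` A).
  move: (infinite_setD Binf ABfin); apply: sub_infinite_set => x [Bx nAB].
  by split=> // Ax; apply: nAB.
have [g ginj [gA gD]] := exists_discrete_sub Delta baseP small Ainf.
have [h hinj [hB hD]] := exists_discrete_sub Delta baseP small BAinf.
pose f n := if odd n then h n./2 else g n./2.
have finj : injective f.
  move=> m n fmn; rewrite -(odd_double_half m) -(odd_double_half n).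
  move: fmn; rewrite /f; case: (odd m); case: (odd n).
  - by move=> /hinj ->.
  - by move=> hg; have [_ []] := hB m./2; rewrite hg.
  - by move=> gh; have [_ []] := hB n./2; rewrite -gh.
  - by move=> /ginj ->.
exists f; split=> // [E BE|n]; last first.
  by rewrite /f /= odd_double /= uphalf_double doubleK; split; [exact: gA|case: (hB n)].
have /equivalence_relationP[Er Es _] := eqB _ BE.
have := sAB E BE; have := gD E BE; have := hD E BE.
move=> fin1 fin2 fin3; have := conj (conj fin1 fin2) fin3.
rewrite -!finite_setU; apply: sub_finite_set.
have fE n : (range g (f n) /\ A (f n)) \/ (range h (f n) /\ B (f n)).
  by rewrite /f; case: odd; [right|left]; split=> //; case: (hB n./2).
move=> _ [[m _ <-] [_ [[n _ <-] nm Emn]]].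
have [[gm Am]|[hm Bm]] := fE m; have [[gn An]|[hn Bn]] := fE n.
- by left; right; split=> //; exists (f n).
- by right; exists (f m) => //; exists (f n) => //; split=> //; exact: Es.
- by right; exists (f n) => //; exists (f m) => //; split=> //; exact: Es.
- by left; left; split=> //; exists (f n).
Qed.

(** * Equivalence relations generated by a family of relations *)

Definition eqcl (G : relN) : relN :=
  [set p | forall T, equivalence_relation T -> G `<=` T -> T p].

Lemma sub_eqcl G : G `<=` eqcl G.
Proof. by move=> p Gp T _; exact. Qed.

Lemma eqcl_min G T : equivalence_relation T -> G `<=` T -> eqcl G `<=` T.
Proof. by move=> eqT GT p; exact. Qed.

Lemma eqcl_equivalence G : equivalence_relation (eqcl G).
Proof.
apply/equivalence_relationP; split.
- by move=> x T /equivalence_relationP[Tr _ _] _; exact: Tr.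
- move=> x y Gxy T eqT GT; have /equivalence_relationP[_ Ts _] := eqT.
  exact: Ts (Gxy T eqT GT).
- move=> x y z Gxy Gyz T eqT GT; have /equivalence_relationP[_ _ Tt] := eqT.
  exact: Tt (Gxy T eqT GT) (Gyz T eqT GT).
Qed.

Lemma eqcl_mono G G' : G `<=` G' -> eqcl G `<=` eqcl G'.
Proof.
by move=> GG'; apply: eqcl_min (eqcl_equivalence _) (subset_trans GG' (@sub_eqcl _)).
Qed.

(** The finite squares make any two points of [nat] related in some [join]. *)
Definition join n (F : set relN) : relN :=
  eqcl (`I_n `*` `I_n `|` \bigcup_(R in F) R).

Lemma join_mono m n F G : m <= n -> F `<=` G -> join m F `<=` join n G.
Proof.
move=> mn FG; apply: eqcl_mono => p [[p1 p2]|[R FR Rp]].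
  by left; split; [exact: leq_trans mn|exact: leq_trans mn].
by right; exists R => //; exact: FG.
Qed.

Definition joins (Q : set relN) : set relN :=
  [set E | exists n F, [/\ finite_set F, F `<=` Q & E = join n F]].

Lemma joins_mono Q Q' : Q `<=` Q' -> joins Q `<=` joins Q'.
Proof.
move=> QQ' E [n [F [Ffin FQ ->]]]; exists n, F; split=> //.
exact: subset_trans QQ'.
Qed.

Lemma joins1 Q R : Q R -> joins Q (join 0 [set R]) /\ R `<=` join 0 [set R].
Proof.
move=> QR; split; last by move=> p Rp; apply: sub_eqcl; right; exists R.
by exists 0, [set R]; split=> // _ ->.
Qed.

Definition finitary_family (Q : set relN) :=
  forall E, joins Q E -> bounded_sections E.

Lemma equivalence_base_joins Q :
  finitary_family Q -> equivalence_base (joins Q).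
Proof.
move=> Qfin; split=> //.
- by move=> _ [n [F [_ _ ->]]]; exact: eqcl_equivalence.
- move=> _ _ [m [F [Ffin FQ ->]]] [n [G [Gfin GQ ->]]].
  exists (join (maxn m n) (F `|` G)); split.
  + exists (maxn m n), (F `|` G); split=> //; first by rewrite finite_setU.
    by move=> R [/FQ|/GQ].
  + by apply: join_mono; [exact: leq_maxl|left].
  + by apply: join_mono; [exact: leq_maxr|right].
- move=> x y; exists (join (maxn x y).+1 set0).
    by exists (maxn x y).+1, set0; split.
  by apply: sub_eqcl; left; split; rewrite /= ltnS ?leq_maxl ?leq_maxr.
Qed.

Lemma joins_card_le (U : pointedType) (K : set U) Q :
  infinite_set K -> Q #<= K -> joins Q #<= K.
Proof.
move=> Kinf /card_le_fun[q qK qinj].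
have /card_le_fun[c cK cinj] : [set: nat] #<= K by exact/infiniteP.
apply: card_le_trans (card_seq_le Kinf); apply/card_le_relP.
exists (fun E t => exists n (s : seq relN), [/\ forall R, R \in s -> Q R,
  E = join n [set` s] & t = c n :: map q s]); split.
  move=> _ [n [F [/finite_seqP[s ->] sQ ->]]].
  exists (c n :: map q s); last by exists n, s.
  move=> x; rewrite inE => /orP[/eqP->|/mapP[R /sQ QR ->]]; first exact: cK.
  exact: qK.
move=> E E' t _ _ _ [n [s [sQ -> ->]]] [n' [s' [sQ' -> [/cinj -/(_ I I)->]]]].
suff: map q s = map q s' -> s = s' by move=> /[apply] ->.
elim: s s' sQ sQ' => [|R s IH] [|R' s'] //= sQ sQ' [/qinj-> //].
- move=> /IH -> // R'' R''s; first by apply: sQ; rewrite inE R''s orbT.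
  by apply: sQ'; rewrite inE R''s orbT.
- by apply: sQ; rewrite mem_head.
- by apply: sQ'; rewrite mem_head.
Qed.

Lemma joins_small Q : ~ (continuum #<= Q) -> ~ (continuum #<= joins Q).
Proof.
move=> Qsmall big; have [Qfin|Qinf] := pselect (finite_set Q).
  apply: Cantor_nat; apply: card_le_trans big _; apply: joins_card_le.
    exact: infinite_nat.
  exact: finite_set_countable.
apply: Qsmall; apply: card_le_trans big _.
exact: joins_card_le Qinf (card_lexx Q).
Qed.

Lemma finitary_family0 : finitary_family set0.
Proof.
move=> _ [n [F [_ F0 ->]]].
pose T : relN := [set p | p.1 = p.2 \/ (p.1 < n /\ p.2 < n)].
apply: (@sub_bounded_sections _ T); last first.
  exists n.+1 => x; exists (x :: iota 0 n); first by rewrite /= size_iota.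
  by move=> y [/= ->|[_ /= yn]]; rewrite inE ?eqxx // mem_iota /= add0n yn orbT.
apply: eqcl_min; last by move=> p [[p1 p2]|[R /F0]//]; right.
apply/equivalence_relationP; split=> [x|x y|x y z]; rewrite /T /=; first by left.
  by move=> [->|[xn yn]]; [left|right].
by move=> [->//|[xn yn]] [<-|[_ zn]]; right.
Qed.

(** * Adjoining a pairing of the points of a discrete sequence *)

(** The two pairings of [nat]: the blocks are {0,1}, {2,3}, ... for
   [b = false], and {0}, {1,2}, {3,4}, ... for [b = true]. *)
Definition linked (b : bool) i j := ((b + i)./2 == (b + j)./2).

Lemma linked_near b i j : linked b i j -> j \in [:: i.-1; i; i.+1].
Proof.
by rewrite /linked !inE; case: b; lia.
Qed.

Definition link (b : bool) (f : nat -> nat) : relN :=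
  [set p | exists i j, linked b i j /\ p = (f i, f j)].

(** Let [W] be the union of the [E]-classes of the points [f k] such that [f k] is
   [E]-related to another [f j], or is linked to such a point. It is finite and
   closed under [E] and under the links, and outside [W] an [E]-class contains at
   most one [f i]. So [T] merges [W] into one class and, outside [W], glues the
   classes of linked points two by two. *)
Lemma adjoin_link E b f : equivalence_relation E -> bounded_sections E ->
  injective f ->
  finite_set [set i | exists j, j <> i /\ E (f i, f j)] ->
  exists T, [/\ equivalence_relation T, bounded_sections T, E `<=` T &
    link b f `<=` T].
Proof.
move=> eqE [n En] finj I0fin; have /equivalence_relationP[Er Es Et] := eqE.
pose I1 := [set k | exists i, (exists j, j <> i /\ E (f i, f j)) /\ linked b i k].
have I1fin : finite_set I1.
  apply: (@sub_finite_set _ _ (\bigcup_(i in [set i | exists j, j <> i /\ E (f i, f j)])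
     [set` [:: i.-1; i; i.+1]])); last exact: bigcup_finite.
  by move=> k [i [Ii /linked_near ik]]; exists i.
have I1link i k : I1 i -> linked b i k -> I1 k.
  move=> [j [Ij ji]] ik; exists j; split=> //.
  by move: ji ik; rewrite /linked => /eqP-> .
have linkC i k : linked b i k -> linked b k i by rewrite /linked eq_sym.
have linkT i j k : linked b i j -> linked b j k -> linked b i k.
  by rewrite /linked => /eqP->.
pose W := \bigcup_(k in I1) [set y | E (f k, y)].
have Wfin : finite_set W.
  by apply: bigcup_finite => // k _; apply: bounded_sections_finite; exists n.
have WE x y : W x -> E (x, y) -> W y.
  by move=> [k Ik Ex] Exy; exists k => //; exact: Et Ex Exy.
have WI1 i : W (f i) -> I1 i.
  move=> [k Ik Eki]; have [<- //|ki] := eqVneq k i.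
  exists i; split; last by rewrite /linked.
  by exists k; split; [exact/eqP|exact: Es].
have uniq i j : ~ I1 i -> E (f i, f j) -> i = j.
  move=> nI Eij; apply: contrapT => ij; apply: nI; exists i.
  by split; [exists j; split=> // ji; apply: ij|rewrite /linked].
pose T : relN := [set p | [\/ W p.1 /\ W p.2, E p |
  exists i j, [/\ ~ I1 i, linked b i j, E (p.1, f i) & E (p.2, f j)]]].
exists T; split.
- apply/equivalence_relationP; split.
  + by move=> x; constructor 2.
  + move=> x y [[Wx Wy]|Exy|[i [j [nI ij Ex Ey]]]].
    * by constructor 1.
    * by constructor 2; exact: Es.
    * constructor 3; exists j, i; split=> //; last exact: linkC.
      by move=> Ij; apply: nI; apply: I1link Ij _; exact: linkC.
  + move=> x y z [[/= Wx Wy]|Exy|[i [j [nI ij /= Ex Ey]]]].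
    * move=> [[/= _ Wz]|/= Eyz|[k [l [nK kl /= Ey Ez]]]].
      - by constructor 1.
      - by constructor 1; split=> //; exact: WE Eyz.
      - by exfalso; apply/nK/WI1; exact: WE Ey.
    * move=> [[/= Wy Wz]|Eyz|[k [l [nK kl /= Ey Ez]]]].
      - by constructor 1; split=> //; apply: WE Wy _; exact: Es.
      - by constructor 2; exact: Et Eyz.
      - by constructor 3; exists k, l; split=> //; exact: Et Ey.
    * have nJ : ~ I1 j by move=> Ij; apply: nI; apply: I1link Ij _; exact: linkC.
      move=> [[/= Wy Wz]|Eyz|[k [l [nK kl /= Ey' Ez]]]].
      - by exfalso; apply/nJ/WI1; exact: WE Ey.
      - by constructor 3; exists i, j; split=> //; apply: Et Ey; exact: Es.
      - have jk : j = k by apply: uniq => //; apply: Et (Es _ _ Ey) Ey'.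
        constructor 3; exists i, l; split=> //; apply: linkT ij _.
        by rewrite jk.
- have /finite_seqP[w WE'] := Wfin.
  exists (size w + n + (n + n + n)) => x; have [s sn sE] := En x.
  have [t tn tE] : exists2 t : seq nat, size t <= n + n + n & forall i j y,
      ~ I1 i -> linked b i j -> E (x, f i) -> E (y, f j) -> y \in t.
    have [[i [nI Ei]]|ni] := pselect (exists i, ~ I1 i /\ E (x, f i)); last first.
      by exists [::] => // i j y nI _ Ei; exfalso; apply: ni; exists i.
    have [s1 s1n s1E] := En (f i.-1).
    have [s2 s2n s2E] := En (f i).
    have [s3 s3n s3E] := En (f i.+1).
    exists (s1 ++ s2 ++ s3).
      by rewrite !size_cat addnA !leq_add.
    move=> i' j y nI' ij' Ei' Ey.
    have ii : i = i' by apply: uniq nI _; apply: Et Ei'; exact: Es.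
    move: ij' Ey; rewrite -ii => /linked_near; rewrite !inE !mem_cat.
    by move=> /or3P[] /eqP-> /Es Ey; apply/or3P;
      [constructor 1; exact: s1E|constructor 2; exact: s2E|constructor 3; exact: s3E].
  exists (w ++ s ++ t); first by rewrite !size_cat addnA !leq_add.
  move=> y [[_ Wy]|Exy|[i [j [nI ij Ex Ey]]]]; rewrite !mem_cat; apply/or3P.
  + by constructor 1; rewrite WE' in Wy.
  + by constructor 2; exact: sE.
  + by constructor 3; exact: tE Ex Ey.
- by move=> p Ep; constructor 2.
- move=> _ [i [j [ij ->]]]; have [Ii|nI] := pselect (I1 i).
    constructor 1; split=> /=; first by exists i => //; exact: Er.
    by exists j; [exact: I1link ij|exact: Er].
  by constructor 3; exists i, j.
Qed.

Lemma finitary_familyU Q b f : finitary_family Q -> injective f ->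
  discrete_for (joins Q) (range f) -> finitary_family (Q `|` [set link b f]).
Proof.
move=> Qfin finj fD _ [n [F [Ffin FQ ->]]].
pose E := join n (F `&` Q).
have QE : joins Q E by exists n, (F `&` Q); split=> //; exact: finite_setIl.
have [|T [eqT bndT ET lT]] := adjoin_link b (eqcl_equivalence _) (Qfin E QE) finj.
  apply: sub_finite_set (finite_preimage (B := [set x | range f x /\
    exists y, [/\ range f y, y <> x & E (x, y)]]) (in2W finj) (fD E QE)).
  move=> i [j [ji Eij]]; split; first by exists i.
  by exists (f j); split=> // /finj.
apply: sub_bounded_sections bndT; apply: eqcl_min => // p [np|[R FR Rp]].
  by apply: ET; apply: sub_eqcl; left.
have [QR|lR] := FQ _ FR; last by apply: lT; rewrite -lR.
by apply: ET; apply: sub_eqcl; right; exists R.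
Qed.

(** * The transfinite construction *)

(** What is asked of the sequence whose terms are paired at the stage of
   [(A, B)]. *)
Definition good (base : set relN) (A B : set nat) (f : nat -> nat) := [/\ injective f,
  discrete_for base (range f) &
  infinite_set A -> infinite_set B -> separated_for base A B ->
  forall n, A (f n.*2) /\ B (f n.*2.+1)].

Definition pick (A B : set nat) (Q : set relN) : nat -> nat :=
  xget (id : nat -> nat) [set f | good (joins Q) A B f].

Lemma pickP A B Q : is_Delta_circ_omega continuum ->
  finitary_family Q -> ~ (continuum #<= Q) -> good (joins Q) A B (pick A B Q).
Proof.
move=> Delta Qfin Qsmall.
suff [f fP] : exists f, good (joins Q) A B f by exact: xgetI fP.
have baseP := equivalence_base_joins Qfin.
have small := joins_small Qsmall.
have [[Ainf Binf sAB]|nAB] := pselect [/\ infinite_set A, infinite_set B &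
    separated_for (joins Q) A B].
  have [f [finj fD fAB]] :=
    exists_discrete_interleaving Delta baseP small Ainf Binf sAB.
  by exists f.
have [f finj [_ fD]] := exists_discrete_sub Delta baseP small infinite_nat.
by exists f; split=> // Ainf Binf sAB; exfalso; apply: nAB.
Qed.

(** A set of naturals codes a stage as well as the pair [(evens a, odds a)] that
   is treated at that stage. *)
Definition evens (a : set nat) : set nat := [set n | a n.*2].
Definition odds (a : set nat) : set nat := [set n | a n.*2.+1].

Lemma evens_odds A B : exists a, evens a = A /\ odds a = B.
Proof.
exists [set n | if odd n then B n./2 else A n./2]; split; apply/seteqP; split=> n;
  by rewrite /evens /odds /= odd_double /= ?doubleK ?uphalf_double.
Qed.

Section Tree.
Variable lt : set nat -> set nat -> Prop.
Hypothesis lt_wf : well_founded lt.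
Hypothesis lt_total : forall a b, [\/ lt a b, a = b | lt b a].

(** The sequence at stage [a] depends on the set of earlier relations only, and
   [s] only decides which pairing of it is added. Two constructions that agree
   below [a] therefore pair the terms of the same sequence at [a]. *)
Definition tree_rel (s : set (set nat)) : set nat -> relN :=
  Fix lt_wf (fun _ => relN) (fun a rec =>
    link `[< s a >] (pick (evens a) (odds a)
      [set R | exists b (ltba : lt b a), R = rec b ltba])).

Definition below s a : set relN := tree_rel s @` [set b | lt b a].

Definition path_seq s a := pick (evens a) (odds a) (below s a).

Lemma tree_relE s a : tree_rel s a = link `[< s a >] (path_seq s a).
Proof.
rewrite /tree_rel Fix_eq -/(tree_rel s) => [|b f g fg]; last first.
  congr (link _ (pick _ _ _)); apply/seteqP; split=> R [c [ltcb ->]];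
  by exists c, ltcb; rewrite fg.
congr (link _ (pick _ _ _)); apply/seteqP; split=> R.
  by move=> [b [ltba ->]]; exists b.
by move=> [b ltba <-]; exists b, ltba.
Qed.

(** A finite set of relations of the tree is treated at the latest of its stages,
   which reduces finitarity to one step. *)
Lemma finite_subtree s (P : set (set nat)) (F : set relN) : finite_set F ->
  F `<=` tree_rel s @` P ->
  F = set0 \/ exists2 a, P a & F `<=` below s a `|` [set tree_rel s a].
Proof.
move=> /finite_seqP[t ->]; elim: t => [|R t IH] tP.
  by left; apply/seteqP; split=> R' //=; rewrite in_nil.
right; have [|t0|[a Pa ta]] := IH.
- by move=> R' R't; apply: tP; rewrite /= inE R't orbT.
- have [|a Pa aR] := tP R; first by rewrite /= mem_head.
  exists a => // R'; rewrite /= inE => /orP[/eqP->|R't]; first by right.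
  by have : [set` t] R' by []; rewrite t0.
have [|b Pb bR] := tP R; first by rewrite /= mem_head.
have below_step a1 a2 : lt a1 a2 ->
    below s a1 `|` [set tree_rel s a1] `<=` below s a2.
  move=> lt12 R' [[c ltc1 <-]|->]; last by exists a1.
  by exists c => //; exact: (wf_total_trans lt_wf lt_total ltc1 lt12).
have [ltab|ab|ltba] := lt_total a b.
- exists b => // R'; rewrite /= inE => /orP[/eqP->|/ta]; first by right.
  by left; exact: below_step ltab _ _.
- exists a => // R'; rewrite /= inE => /orP[/eqP->|/ta //].
  by right; rewrite ab.
- exists a => // R'; rewrite /= inE => /orP[/eqP->|/ta //].
  by left; exists b.
Qed.

Hypothesis Delta : is_Delta_circ_omega continuum.
Hypothesis lt_small : forall a, ~ (continuum #<= [set b | lt b a]).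

Lemma below_small s a : ~ (continuum #<= below s a).
Proof.
move=> big; apply: (lt_small (a := a)); apply: card_le_trans big _.
exact: card_image_le.
Qed.

Lemma finitary_subtree s P :
  (forall a, P a -> finitary_family (below s a)) ->
  finitary_family (tree_rel s @` P).
Proof.
move=> IH _ [n [F [Ffin FP ->]]].
have [->|[a Pa Fa]] := finite_subtree Ffin FP.
  by apply: finitary_family0; exists n, set0; split.
have [finj fD _] := pickP (evens a) (odds a) Delta (IH a Pa) (@below_small s a).
apply: (finitary_familyU (b := `[< s a >]) (IH a Pa) finj fD).
by exists n, F; split=> //; rewrite tree_relE in Fa.
Qed.

Lemma finitary_below s a : finitary_family (below s a).
Proof.
elim/(well_founded_ind lt_wf): a => a IH.
by apply: finitary_subtree => b; exact: IH.
Qed.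

Lemma path_seqP s a :
  good (joins (below s a)) (evens a) (odds a) (path_seq s a).
Proof. exact: pickP Delta (@finitary_below s a) (@below_small s a). Qed.

Definition branch s : set relN := joins (range (tree_rel s)).

Lemma branchP s : equivalence_base (branch s).
Proof.
apply: equivalence_base_joins; apply: finitary_subtree => a _.
exact: finitary_below.
Qed.

Lemma branch_link s a :
  exists2 E, branch s E & link `[< s a >] (path_seq s a) `<=` E.
Proof.
have [BE sE] : _ := @joins1 (range (tree_rel s)) (tree_rel s a) (imageP _ I).
by exists (join 0 [set tree_rel s a]) => //; rewrite -tree_relE.
Qed.

(** If [A] and [B] were separated in the end, they were separated at the stage
   that codes them, where infinitely many points of [A] got linked to [B]. *)
Lemma inseparated_branch s : inseparated (coarse_of (branch s)).
Proof.
have BP := branchP s; split; first by move=> /(bounded_coarse_of BP)/infinite_nat.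
move=> [A [B [Aunb Bunb /(separated_coarse_of _ _ BP) sAB]]].
have unb C : ~ bounded (coarse_of (branch s)) C -> infinite_set C.
  by move=> + Cfin; apply; exact/(bounded_coarse_of BP).
have [a [aA aB]] := evens_odds A B.
have [finj _] := path_seqP s a; rewrite aA aB => good_fAB.
have {good_fAB} fAB := good_fAB (unb _ Aunb) (unb _ Bunb) _.
have {}fAB n : A (path_seq s a n.*2) /\ B (path_seq s a n.*2.+1).
  apply: fAB => E BE; apply: sAB; apply: joins_mono BE => _ [b _ <-].
  by exists b.
have [E BE lE] := branch_link s a.
have [/(_ _ BE)/equivalence_relationP[Er Es _] _ _ _] := BP.
have : infinite_set [set path_seq s a n.*2.+2 | n in [set: nat]].
  rewrite (eq_finite_set (inj_card_eq _)); first exact: infinite_nat.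
  by move=> m n _ _ /finj; lia.
apply; apply: sub_finite_set (sAB E BE) => _ [n _ <-].
(* Every even index but 0 is linked to an odd one, whichever the pairing. *)
exists (path_seq s a n.*2.+2).
  by have [+ _] := fAB n.+1; rewrite doubleS.
have fB : exists m, linked `[< s a >] m.*2.+1 n.*2.+2.
  by case: asboolP => _; [exists n|exists n.+1]; rewrite /linked; lia.
have [m lm] := fB; exists (path_seq s a m.*2.+1); first by have [] := fAB m.
by split; [exact: Er|apply: lE; exists m.*2.+1, n.*2.+2].
Qed.

(** At the first stage where [s] and [t] differ, both pairings of one sequence are
   used; an equivalence relation containing both contains all pairs
   [(f i, f i.+1)], so that one of its classes is infinite. *)
Lemma branch_inj s t : coarse_of (branch s) = coarse_of (branch t) -> s = t.
Proof.
move=> st; suff agree a : s a <-> t a by apply/seteqP; split=> a /agree.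
elim/(well_founded_ind lt_wf): a => a IH.
have below_eq : below s a = below t a.
  have tree_eq b : lt b a -> tree_rel s b = tree_rel t b.
    elim/(well_founded_ind lt_wf): b => b IHb ltba.
    rewrite !tree_relE (asbool_equiv_eq (IH b ltba)); congr (link _ (pick _ _ _)).
    by apply/seteqP; split=> _ [c ltcb <-]; exists c => //; rewrite IHb //;
      exact: (wf_total_trans lt_wf lt_total ltcb ltba).
  by apply/seteqP; split=> _ [c ltca <-]; exists c => //; rewrite tree_eq.
have path_eq : path_seq s a = path_seq t a by rewrite /path_seq below_eq.
apply: contrapT => nst.
have neq : `[< t a >] = ~~ `[< s a >].
  case: (asboolP (s a)) nst => sa; case: asboolP => ta // nst; exfalso.
    by apply: nst.
  by apply: nst; split.
have [E BE lE] := branch_link s a; have [F BF lF] := branch_link t a.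
have [F' BF' FF'] : exists2 F', branch s F' & F `<=` F'.
  have : coarse_of (branch s) F by rewrite st; apply: base_coarse_of => //; exact: branchP.
  by case.
have [eqB bndB dirB _] := branchP s.
have [G [BG EG FG]] := dirB _ _ BE BF'.
have /equivalence_relationP[Gr Gs Gt] := eqB _ BG.
have [finj _ _] := path_seqP s a; set f := path_seq s a in finj path_eq lE.
have Gstep i : G (f i, f i.+1).
  have [l|l] : linked `[< s a >] i i.+1 \/ linked `[< t a >] i i.+1.
  - by rewrite neq /linked; case: `[< s a >]; lia.
  - by apply/EG/lE; exists i, i.+1.
  - by apply/FG/FF'/lF; rewrite -path_eq; exists i, i.+1.
have G0 i : G (f 0, f i).
  by elim: i => // i IHi; exact: Gt IHi (Gstep i).
have rf : infinite_set (range f).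
  rewrite (eq_finite_set (inj_card_eq _)); first exact: infinite_nat.
  by move=> m n _ _ /finj.
apply: rf; apply: sub_finite_set (bounded_sections_finite (f 0) (bndB _ BG)).
by move=> _ [i _ <-]; exact: G0.
Qed.

End Tree.

Lemma image_set_inj T U (f : T -> U) : injective f -> injective (image^~ f).
Proof.
move=> finj A B AB; apply/seteqP.
by split=> x Sx; [rewrite -(image_inj finj) -AB|rewrite -(image_inj finj) AB];
  exists x.
Qed.

Theorem corollary5p10 :
  is_Delta_circ_omega continuum ->
  [set cE : set (set (nat * nat)) |
    [/\ coarse_structure cE, inseparated cE, cellular cE & finitary cE]]
  #= [set: set (set nat)].
Proof.
move=> Delta; rewrite card_eq_le; apply/andP; split.
  apply: card_le_trans (card_leT _) _.
  have pickle_inj := pcan_inj (@choice.pickleK (nat * nat)%type).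
  apply: (@card_le_inj _ _ (image^~ (image^~ choice.pickle))) => // C D _ _.
  exact/image_set_inj/image_set_inj.
have [lt [wf tot small]] := exists_small_well_order (set nat).
apply: (@card_le_inj _ _ (fun s => coarse_of (branch wf s))) => [s _|s t _ _].
  have BP := branchP wf tot Delta small s; split.
  - exact: coarse_structure_coarse_of.
  - exact: inseparated_branch.
  - exact: cellular_coarse_of.
  - exact: finitary_coarse_of.
exact: branch_inj.
Qed.
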